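(* Let $(\mathbf c^k)_{k\in\mathbb N}$, $(\tilde{\mathbf c}^k)_{k\in\mathbb N}$ be generated by any one of the six hybrid schemes MIX-I, ..., MIX-VI (listed in the context, with the stated conditions on the metrics), and let $\mathbf c^\star\in\mathrm{zer}\,\mathcal A$ be a saddle point. Then the generalized Bregman distance $\Pi(\cdot,\mathbf c^\star)$ generated by $f(\mathbf x)+g(\mathbf a)+h^*(\mathbf b)$ between the ergodic point $\frac1k\sum_{i=0}^{k-1}\tilde{\mathbf c}^i$ and $\mathbf c^\star$ has a rate of $O(1/k)$: for every $k\ge1$, $$0\le\Pi\Big(\frac1k\sum_{i=0}^{k-1}\tilde{\mathbf c}^i,\ \mathbf c^\star\Big)\le\frac1{2k}\,\big\|\mathbf c^0-\mathbf c^\star\big\|_{\mathcal S}^2 .$$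
   Context: Let $f:\mathbb R^N\to\mathbb R\cup\{+\infty\}$, $g:\mathbb R^{M_1}\to\mathbb R\cup\{+\infty\}$, $h:\mathbb R^{M_2}\to\mathbb R\cup\{+\infty\}$ be proper, lower semicontinuous and convex, $h^*$ the Fenchel conjugate of $h$, and $\mathbf A:\mathbb R^N\to\mathbb R^{M_1}$, $\mathbf B:\mathbb R^N\to\mathbb R^{M_2}$ linear. Let $$\mathcal L(\mathbf x,\mathbf a,\mathbf b,\mathbf p)=f(\mathbf x)+g(\mathbf a)+\langle\mathbf p,\mathbf A\mathbf x-\mathbf a\rangle+\langle\mathbf b,\mathbf B\mathbf x\rangle-h^*(\mathbf b).$$ Write $\mathbf c=(\mathbf x,\mathbf a,\mathbf b,\mathbf p)\in\mathbb R^N\times\mathbb R^{M_1}\times\mathbb R^{M_2}\times\mathbb R^{M_1}$ and $$\Pi(\mathbf c,\mathbf c')=\mathcal L(\mathbf x,\mathbf a,\mathbf b',\mathbf p')-\mathcal L(\mathbf x',\mathbf a',\mathbf b,\mathbf p).$$ For $\mathbf c^\star\in\mathrm{zer}\,\mathcal A$ (with $\mathcal A$ below), $\Pi(\mathbf c,\mathbf c^\star)$ is the generalized Bregman distance $q(\mathbf u)-q(\mathbf u^\star)-\langle\mathbf v,\mathbf u-\mathbf u^\star\rangle$ of $q(\mathbf x,\mathbf a,\mathbf b)=f(\mathbf x)+g(\mathbf a)+h^*(\mathbf b)$, with $\mathbf u=(\mathbf x,\mathbf a,\mathbf b)$ and $\mathbf v=(-\mathbf B^\top\mathbf b^\star-\mathbf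 A^\top\mathbf p^\star,\mathbf p^\star,\mathbf B\mathbf x^\star)\in\partial q(\mathbf u^\star)$. $\mathbb S_+$ (resp. $\mathbb S_{++}$): symmetric positive semidefinite (resp. definite) matrices; $X\succ Y$ means $X-Y\in\mathbb S_{++}$; $\|\mathbf c\|_{\mathcal S}^2=\langle\mathbf c,\mathcal S\mathbf c\rangle$; $\mathbf I$ is the identity. $\mathbf M$ ($N\times N$), $\mathbf\Omega,\mathbf\Theta$ ($M_1\times M_1$), $\mathbf\Gamma$ ($M_2\times M_2$) are symmetric (proximal metrics), with $\mathbf\Theta,\mathbf\Gamma$ invertible. Let $$\mathcal A=\begin{bmatrix}\partial f&0&\mathbf B^\top&\mathbf A^\top\\0&\partial g&0&-\mathbf I\\-\mathbf B&0&\partial h^*&0\\-\mathbf A&\mathbf I&0&0\end{bmatrix},\qquad\mathrm{zer}\,\mathcal A=\{\mathbf c:0\in\mathcal A\mathbf c\}.$$ Each scheme is a generalized proximal point algorithm $$0\in\mathcal A\tilde{\mathbf c}^k+\mathcal Q(\tilde{\mathbf c}^k-\mathbf c^k),\qquad\mathbf c^{k+1}=\mathbf c^k+\mathcal M(\tilde{\mathbf c}^k-\mathbf c^k),$$ where $\tilde{\mathbf c}^k=(\tilde{\mathbf x}^k,\tilde{\mathbf a}^k,\tilde{\mathbf b}^k,\tilde{\mathbf p}^k)$ is the proximal output; $\mathcal S=\mathcal Q\mathcal M^{-1}$, $\mathcal G=\mathcal Q+\mathcal Q^\top-\mathcal M^\top\mathcal Q$. Iterates are assumed to exist. Conditions: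 $\mathcal S,\mathcal G\in\mathbb S_{++}$, except for MIX-IV, where only $\mathbf M,\mathbf\Theta,\mathbf\Gamma\in\mathbb S_{++}$, $\mathbf\Omega\in\mathbb S_+$ and $\mathbf M\succ\mathbf A^\top\mathbf\Theta\mathbf A+\mathbf B^\top\mathbf\Gamma\mathbf B$ is required. Notation: $P_\varphi(B;\mathbf w)=\arg\min_{\mathbf u}\varphi(\mathbf u)+\frac12\langle\mathbf u,B\mathbf u\rangle-\langle\mathbf w,\mathbf u\rangle$ ($=\mathrm{prox}_\varphi^B(B^{-1}\mathbf w)$, where $\mathrm{prox}_\varphi^B(\mathbf u)=\arg\min_{\mathbf w}\varphi(\mathbf w)+\frac12\|\mathbf w-\mathbf u\|_B^2$). MIX-I: $\mathcal Q=\begin{bmatrix}\mathbf M&0&-\mathbf B^\top&-\mathbf A^\top\\0&\mathbf\Omega&0&\mathbf I\\-\mathbf B&0&\mathbf\Gamma^{-1}&0\\-\mathbf A&\mathbf I&0&\mathbf\Theta^{-1}\end{bmatrix}$, $\mathcal M=\mathbf I$; i.e. $\mathbf x^{k+1}=P_f(\mathbf M;\mathbf M\mathbf x^k-\mathbf A^\top\mathbf p^k-\mathbf B^\top\mathbf b^k)$, $\mathbf a^{k+1}=P_g(\mathbf\Omega;\mathbf\Omega\mathbf a^k+\mathbf p^k)$, $\mathbf b^{k+1}=\mathrm{prox}_{h^*}^{\mathbf\Gamma^{-1}}(\mathbf b^k+\mathbf\Gamma\mathbf B(2\mathbf x^{k+1}-\mathbf x^k))$, $\mathbf p^{k+1}=\mathbf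 p^k+\mathbf\Theta(\mathbf A(2\mathbf x^{k+1}-\mathbf x^k)-(2\mathbf a^{k+1}-\mathbf a^k))$. MIX-II: $\mathcal Q=\begin{bmatrix}\mathbf M&0&-\mathbf B^\top&-\mathbf A^\top\\0&\mathbf\Omega&0&-\mathbf I\\-\mathbf B&0&\mathbf\Gamma^{-1}&0\\-\mathbf A&-\mathbf I&0&\mathbf\Theta^{-1}\end{bmatrix}$, $\mathcal M=\mathbf I$; i.e. $\mathbf x^{k+1}=P_f(\mathbf M;\mathbf M\mathbf x^k-\mathbf B^\top\mathbf b^k-\mathbf A^\top\mathbf p^k)$, $\mathbf p^{k+1}=\mathbf p^k+\mathbf\Theta(\mathbf A(2\mathbf x^{k+1}-\mathbf x^k)-\mathbf a^k)$, $\mathbf a^{k+1}=P_g(\mathbf\Omega;\mathbf\Omega\mathbf a^k+2\mathbf p^{k+1}-\mathbf p^k)$, $\mathbf b^{k+1}=\mathrm{prox}_{h^*}^{\mathbf\Gamma^{-1}}(\mathbf b^k+\mathbf\Gamma\mathbf B(2\mathbf x^{k+1}-\mathbf x^k))$. MIX-III: $\mathcal Q=\begin{bmatrix}\mathbf M&0&-\mathbf B^\top&0\\0&\mathbf\Omega&0&-\mathbf I\\-\mathbf B&0&\mathbf\Gamma^{-1}&0\\0&-\mathbf I&0&\mathbf\Theta^{-1}\end{bmatrix}$, $\mathcal M=\mathbf I$; i.e. $\mathbf x^{k+1}=P_f(\mathbf M+\mathbf A^\top\mathbf\Theta\mathbf A;\mathbf M\mathbf x^k+\mathbf A^\top\mathbf\Theta\mathbf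 a^k-\mathbf B^\top\mathbf b^k-\mathbf A^\top\mathbf p^k)$, $\mathbf p^{k+1}=\mathbf p^k+\mathbf\Theta(\mathbf A\mathbf x^{k+1}-\mathbf a^k)$, $\mathbf a^{k+1}=P_g(\mathbf\Omega;\mathbf\Omega\mathbf a^k+2\mathbf p^{k+1}-\mathbf p^k)$, $\mathbf b^{k+1}=\mathrm{prox}_{h^*}^{\mathbf\Gamma^{-1}}(\mathbf b^k+\mathbf\Gamma\mathbf B(2\mathbf x^{k+1}-\mathbf x^k))$. MIX-IV: $\mathcal Q=\begin{bmatrix}\mathbf M&0&-\mathbf B^\top&-\mathbf A^\top\\0&\mathbf\Omega&0&0\\0&0&\mathbf\Gamma^{-1}&0\\0&0&0&\mathbf\Theta^{-1}\end{bmatrix}$, $\mathcal M=\begin{bmatrix}\mathbf I&0&0&0\\0&\mathbf I&0&0\\\mathbf\Gamma\mathbf B&0&\mathbf I&0\\\mathbf\Theta\mathbf A&0&0&\mathbf I\end{bmatrix}$; i.e. $\mathbf x^{k+1}=P_f(\mathbf M;\mathbf M\mathbf x^k-\mathbf A^\top\mathbf p^k-\mathbf B^\top\mathbf b^k)$, $\mathbf a^{k+1}=P_g(\mathbf\Omega+\mathbf\Theta;\mathbf\Omega\mathbf a^k+\mathbf p^k+\mathbf\Theta\mathbf A\mathbf x^{k+1})$, $\mathbf b^{k+1}=\mathrm{prox}_{h^*}^{\mathbf\Gamma^{-1}}(\mathbf b^k+\mathbf\Gamma\mathbf B\mathbf x^{k+1})+\mathbf\Gamma\mathbf B(\mathbf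 x^{k+1}-\mathbf x^k)$, $\mathbf p^{k+1}=\mathbf p^k+\mathbf\Theta(2\mathbf A\mathbf x^{k+1}-\mathbf A\mathbf x^k-\mathbf a^{k+1})$. MIX-V: $\mathcal Q=\begin{bmatrix}\mathbf M&0&-\mathbf B^\top&-\mathbf A^\top\\0&\mathbf\Omega&0&\mathbf I\\0&0&\mathbf\Gamma^{-1}&0\\0&0&0&\mathbf\Theta^{-1}\end{bmatrix}$, $\mathcal M=\begin{bmatrix}\mathbf I&0&0&0\\0&\mathbf I&0&0\\\mathbf\Gamma\mathbf B&0&\mathbf I&0\\\mathbf\Theta\mathbf A&-\mathbf\Theta&0&\mathbf I\end{bmatrix}$; i.e. $\mathbf x^{k+1}=P_f(\mathbf M;\mathbf M\mathbf x^k-\mathbf A^\top\mathbf p^k-\mathbf B^\top\mathbf b^k)$, $\mathbf a^{k+1}=P_g(\mathbf\Omega;\mathbf\Omega\mathbf a^k+\mathbf p^k)$, $\mathbf b^{k+1}=\mathrm{prox}_{h^*}^{\mathbf\Gamma^{-1}}(\mathbf b^k+\mathbf\Gamma\mathbf B\mathbf x^{k+1})+\mathbf\Gamma\mathbf B(\mathbf x^{k+1}-\mathbf x^k)$, $\mathbf p^{k+1}=\mathbf p^k+\mathbf\Theta(\mathbf A(2\mathbf x^{k+1}-\mathbf x^k)-(2\mathbf a^{k+1}-\mathbf a^k))$. MIX-VI: $\mathcal Q=\begin{bmatrix}\mathbf M&0&-\mathbf B^\top&0\\0&\mathbf\Omega&0&0\\-\mathbf B&0&\mathbf\Gamma^{-1}&0\\0&-\mathbf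 I&0&\mathbf\Theta^{-1}\end{bmatrix}$, $\mathcal M=\begin{bmatrix}\mathbf I&0&0&0\\0&\mathbf I&0&0\\0&0&\mathbf I&0\\0&-\mathbf\Theta&0&\mathbf I\end{bmatrix}$; i.e. $\mathbf x^{k+1}=P_f(\mathbf M+\mathbf A^\top\mathbf\Theta\mathbf A;\mathbf M\mathbf x^k+\mathbf A^\top\mathbf\Theta\mathbf a^k-\mathbf B^\top\mathbf b^k-\mathbf A^\top\mathbf p^k)$, $\mathbf a^{k+1}=P_g(\mathbf\Omega;\mathbf\Omega\mathbf a^k+\mathbf\Theta\mathbf A\mathbf x^{k+1}-\mathbf\Theta\mathbf a^k+\mathbf p^k)$, $\mathbf b^{k+1}=\mathrm{prox}_{h^*}^{\mathbf\Gamma^{-1}}(\mathbf b^k+\mathbf\Gamma\mathbf B(2\mathbf x^{k+1}-\mathbf x^k))$, $\mathbf p^{k+1}=\mathbf p^k+\mathbf\Theta(\mathbf A\mathbf x^{k+1}-\mathbf a^{k+1})$. *)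

(* Defs.v *)
From HB Require Import structures.
From mathcomp Require Import all_boot all_order all_algebra.
From mathcomp Require Import all_classical all_reals all_analysis.
From mathcomp Require Import ring.

Set Implicit Arguments.
Unset Strict Implicit.
Unset Printing Implicit Defensive.

Import Order.TTheory GRing.Theory Num.Theory.
Import numFieldNormedType.Exports.

Local Open Scope classical_set_scope.
Local Open Scope ring_scope.
Local Open Scope ereal_scope.

Section ConvexAnalysis.
Context {R : realType}.

Definition dot n (u v : 'cV[R]_n) : R := (u^T *m v)%R ord0 ord0.

Definition sqnorm n (S : 'M[R]_n) (u : 'cV[R]_n) : R := dot u (S *m u)%R.

Definition symm n (X : 'M[R]_n) : Prop := X^T%R = X.

Definition psd n (X : 'M[R]_n) : Prop :=
  symm X /\ forall u : 'cV[R]_n, (0 <= sqnorm X u)%R.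

Definition pd n (X : 'M[R]_n) : Prop :=
  symm X /\ forall u : 'cV[R]_n, u != 0%R -> (0 < sqnorm X u)%R.

(* Functions into R \cup {+oo} are functions into \bar R avoiding -oo, which is
   part of properness. *)
Definition proper_efun n (phi : 'cV[R]_n -> \bar R) : Prop :=
  (forall u, phi u != -oo) /\ exists u, phi u != +oo.

(* At the end points t = 0, 1 this uses the convention 0 * +oo = 0 of \bar R,
   and is then trivially true. *)
Definition convex_efun n (phi : 'cV[R]_n -> \bar R) : Prop :=
  forall (u v : 'cV[R]_n) (t : R), (0 <= t <= 1)%R ->
    phi (t *: u + (1 - t) *: v)%R <= t%:E * phi u + (1 - t)%:E * phi v.

Definition proper_lsc_convex n (phi : 'cV[R]_n -> \bar R) : Prop :=
  [/\ proper_efun phi, lower_semicontinuous phi & convex_efun phi].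

Definition conjugate n (phi : 'cV[R]_n -> \bar R) (v : 'cV[R]_n) : \bar R :=
  ereal_sup [set (dot u v)%:E - phi u | u in [set: 'cV[R]_n]].

(* The subdifferential is empty outside the effective domain. *)
Definition subdiff n (phi : 'cV[R]_n -> \bar R) (u : 'cV[R]_n) :
    set 'cV[R]_n :=
  [set v | phi u \is a fin_num /\
           forall w, phi u + (dot v (w - u)%R)%:E <= phi w].

Definition argmin n (F : 'cV[R]_n -> \bar R) : set 'cV[R]_n :=
  [set u | forall w, F u <= F w].

Definition Pmin n (phi : 'cV[R]_n -> \bar R) (B : 'M[R]_n) (w : 'cV[R]_n) :=
  argmin (fun u => phi u + (2^-1 * dot u (B *m u)%R - dot w u)%:E).

Definition prox n (phi : 'cV[R]_n -> \bar R) (B : 'M[R]_n) (v : 'cV[R]_n) :=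
  argmin (fun w => phi w + (2^-1 * sqnorm B (w - v)%R)%:E).

Definition bregman n (q : 'cV[R]_n -> \bar R) (v u u' : 'cV[R]_n) : \bar R :=
  q u - q u' - (dot v (u - u')%R)%:E.

Definition row4 m n1 n2 n3 n4 (A1 : 'M[R]_(m, n1)) (A2 : 'M[R]_(m, n2))
    (A3 : 'M[R]_(m, n3)) (A4 : 'M[R]_(m, n4)) :
    'M[R]_(m, n1 + (n2 + (n3 + n4))) :=
  row_mx A1 (row_mx A2 (row_mx A3 A4)).

Definition col4 m1 m2 m3 m4 n (A1 : 'M[R]_(m1, n)) (A2 : 'M[R]_(m2, n))
    (A3 : 'M[R]_(m3, n)) (A4 : 'M[R]_(m4, n)) :
    'M[R]_(m1 + (m2 + (m3 + m4)), n) :=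
  col_mx A1 (col_mx A2 (col_mx A3 A4)).

End ConvexAnalysis.

Inductive scheme := MIX_I | MIX_II | MIX_III | MIX_IV | MIX_V | MIX_VI.

Section Schemes.
Context {R : realType} {N M1 M2 : nat}.

Notation dimC := (N + (M1 + (M2 + M1)))%N.

Definition cx (c : 'cV[R]_dimC) : 'cV[R]_N := usubmx c.
Definition ca (c : 'cV[R]_dimC) : 'cV[R]_M1 := usubmx (dsubmx c).
Definition cb (c : 'cV[R]_dimC) : 'cV[R]_M2 := usubmx (dsubmx (dsubmx c)).
Definition cp (c : 'cV[R]_dimC) : 'cV[R]_M1 := dsubmx (dsubmx (dsubmx c)).

Section Operators.
Context (f : 'cV[R]_N -> \bar R) (g : 'cV[R]_M1 -> \bar R)
  (h : 'cV[R]_M2 -> \bar R) (A : 'M[R]_(M1, N)) (B : 'M[R]_(M2, N)).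

(* The sum is free of the indeterminate form oo - oo when f and g avoid -oo and
   either [x] and [a] lie in the domains of f and g, or [b] lies in that of
   h^*. *)
Definition lagrangian (x : 'cV[R]_N) (a : 'cV[R]_M1) (b : 'cV[R]_M2)
    (p : 'cV[R]_M1) : \bar R :=
  f x + g a + (dot p (A *m x - a)%R)%:E + (dot b (B *m x)%R)%:E
  - conjugate h b.

Definition Pi (c c' : 'cV[R]_dimC) : \bar R :=
  lagrangian (cx c) (ca c) (cb c') (cp c')
  - lagrangian (cx c') (ca c') (cb c) (cp c).

Definition opA (c : 'cV[R]_dimC) : set 'cV[R]_dimC :=
  [set v | exists vf vg vh,
     [/\ subdiff f (cx c) vf, subdiff g (ca c) vg,
         subdiff (conjugate h) (cb c) vh
       & v = (col4 (vf + B^T *m cb c + A^T *m cp c)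
                   (vg - cp c)
                   (vh - B *m cx c)
                   (ca c - A *m cx c))%R] ].

Definition zerA : set 'cV[R]_dimC := [set c | opA c 0%R].

(* q(x, a, b) = f(x) + g(a) + h^*(b) *)
Definition qfun (u : 'cV[R]_(N + (M1 + M2))) : \bar R :=
  f (usubmx u) + g (usubmx (dsubmx u)) + conjugate h (dsubmx (dsubmx u)).

Definition cu (c : 'cV[R]_dimC) : 'cV[R]_(N + (M1 + M2)) :=
  col_mx (cx c) (col_mx (ca c) (cb c)).

Definition cv (c : 'cV[R]_dimC) : 'cV[R]_(N + (M1 + M2)) :=
  (col_mx (- (B^T *m cb c) - A^T *m cp c) (col_mx (cp c) (B *m cx c)))%R.

(* On zeros of the operator, [Pi] is the generalized Bregman distance of [qfun]. *)
Lemma Pi_bregman (c cs : 'cV[R]_dimC) :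
  proper_efun f -> proper_efun g -> proper_efun h -> zerA cs ->
  subdiff qfun (cu cs) (cv cs) /\
  Pi c cs = bregman qfun (cv cs) (cu c) (cu cs).
Proof.
move=> [f_pr _] [g_pr _] [h_pr [y hy]] [vf] [vg] [vh] [].
move=> [ffin fsub] [gfin gsub] [hfin hsub] /esym e0.
have hs_pr b : conjugate h b != -oo.
  rewrite -ltNye.
  have le1 : (dot y b)%:E - h y <= conjugate h b.
    by apply: ereal_sup_ubound; exists y.
  apply: lt_le_trans le1.
  move: hy (h_pr y); case: (h y) => [r _ _|hy|_ hy].
  - by rewrite -EFinB ltNyr.
  - by rewrite eqxx in hy.
  - by rewrite eqxx in hy.
have := congr1 cx e0; have := congr1 ca e0.
have := congr1 cb e0; have := congr1 cp e0.
rewrite /cx /ca /cb /cp /col4 !col_mxKd !col_mxKu !linear0 -/(cx cs) -/(ca cs).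
rewrite -/(cb cs) -/(cp cs) => /subr0_eq e4 /subr0_eq e3 /subr0_eq e2.
rewrite -addrA => /addr0_eq/(canRL opprK); rewrite opprD => e1.
have dotC n (u v : 'cV[R]_n) : dot u v = dot v u.
  by rewrite /dot !mxE; apply: eq_bigr => i _; rewrite !mxE mulrC.
have dotBr n (u v w : 'cV[R]_n) : dot u (v - w)%R = (dot u v - dot u w)%R.
  by rewrite /dot mulmxBr !mxE.
have dotNl n (u v : 'cV[R]_n) : dot (- u)%R v = (- dot u v)%R.
  by rewrite /dot linearN mulNmx mxE.
have dotBl n (u v w : 'cV[R]_n) : dot (v - w)%R u = (dot v u - dot w u)%R.
  by rewrite dotC dotBr !(dotC _ u).
have dot_tr m n (X : 'M[R]_(m, n)) u v : dot (X^T *m u)%R v = dot u (X *m v)%R.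
  by rewrite /dot trmx_mul trmxK mulmxA.
have dotcol m n (u1 v1 : 'cV[R]_m) (u2 v2 : 'cV[R]_n) :
    dot (col_mx u1 u2) (col_mx v1 v2) = (dot u1 v1 + dot u2 v2)%R.
  by rewrite /dot tr_col_mx mul_row_col mxE.
rewrite {}e1 {}e2 {}e3 in fsub gsub hsub.
split.
  rewrite /subdiff /= /qfun /cu !(col_mxKu, col_mxKd).
  split; first by rewrite !fin_numD ffin gfin hfin.
  move=> w; rewrite -[w]vsubmxK -[dsubmx w]vsubmxK !(col_mxKu, col_mxKd).
  move: (usubmx w) (usubmx (dsubmx w)) (dsubmx (dsubmx w)) => w1 w2 w3.
  apply: le_trans (leeD (leeD (fsub w1) (gsub w2)) (hsub w3)).
  rewrite /cv !(opp_col_mx, add_col_mx) !dotcol.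
  case: (f _) ffin => // ? _; case: (g _) gfin => // ? _.
  case: (conjugate h _) hfin => // ? _.
  by rewrite -!EFinD lee_fin le_eqVlt; apply/orP; left; apply/eqP; ring.
rewrite /Pi /lagrangian /bregman /qfun /cu !(col_mxKu, col_mxKd).
rewrite /cv !(opp_col_mx, add_col_mx) !dotcol -e4 subrr.
rewrite !(dotBl, dotNl, dotBr, dot_tr).
rewrite (dotC _ (B *m cx cs)%R (cb c)) (dotC _ (B *m cx cs)%R (cb cs)).
have [] : dot (cp c) 0%R = 0%R /\ dot (cp cs) 0%R = 0%R.
  by rewrite /dot !mulmx0 mxE.
move=> -> _; rewrite -?e4.
move: (f_pr (cx c)) (g_pr (ca c)) (hs_pr (cb c)).
case: (f (cx cs)) ffin => // ? _; case: (g (ca cs)) gfin => // ? _.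
case: (conjugate h (cb cs)) hfin => // ? _.
case: (f (cx c)) => [?||] // _; case: (g (ca c)) => [?||] // _;
  case: (conjugate h (cb c)) => [?||] // _.
by rewrite -!(EFinD, EFinN); congr EFin; ring.
Qed.

Context (M : 'M[R]_N) (Om Th : 'M[R]_M1) (Ga : 'M[R]_M2).

Definition Qmx (s : scheme) : 'M[R]_dimC := (
  match s with
  | MIX_I =>
    col4 (row4 M     0     (- B^T)   (- A^T))
         (row4 0     Om    0         1%:M)
         (row4 (- B) 0     (invmx Ga) 0)
         (row4 (- A) 1%:M  0         (invmx Th))
  | MIX_II =>
    col4 (row4 M     0       (- B^T)   (- A^T))
         (row4 0     Om      0         (- 1%:M))
         (row4 (- B) 0       (invmx Ga) 0)
         (row4 (- A) (- 1%:M) 0        (invmx Th))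
  | MIX_III =>
    col4 (row4 M     0       (- B^T)   0)
         (row4 0     Om      0         (- 1%:M))
         (row4 (- B) 0       (invmx Ga) 0)
         (row4 0     (- 1%:M) 0        (invmx Th))
  | MIX_IV =>
    col4 (row4 M     0     (- B^T)   (- A^T))
         (row4 0     Om    0         0)
         (row4 0     0     (invmx Ga) 0)
         (row4 0     0     0         (invmx Th))
  | MIX_V =>
    col4 (row4 M     0     (- B^T)   (- A^T))
         (row4 0     Om    0         1%:M)
         (row4 0     0     (invmx Ga) 0)
         (row4 0     0     0         (invmx Th))
  | MIX_VI =>
    col4 (row4 M     0       (- B^T)   0)
         (row4 0     Om      0         0)
         (row4 (- B) 0       (invmx Ga) 0)
         (row4 0     (- 1%:M) 0        (invmx Th))
  end)%R.

Definition Mmx (s : scheme) : 'M[R]_dimC := (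
  match s with
  | MIX_I | MIX_II | MIX_III => 1%:M
  | MIX_IV =>
    col4 (row4 1%:M      0     0     0)
         (row4 0         1%:M  0     0)
         (row4 (Ga *m B) 0     1%:M  0)
         (row4 (Th *m A) 0     0     1%:M)
  | MIX_V =>
    col4 (row4 1%:M      0      0     0)
         (row4 0         1%:M   0     0)
         (row4 (Ga *m B) 0      1%:M  0)
         (row4 (Th *m A) (- Th) 0     1%:M)
  | MIX_VI =>
    col4 (row4 1%:M  0      0     0)
         (row4 0     1%:M   0     0)
         (row4 0     0      1%:M  0)
         (row4 0     (- Th) 0     1%:M)
  end)%R.

Definition Smx (s : scheme) : 'M[R]_dimC := (Qmx s *m invmx (Mmx s))%R.

Definition Gmx (s : scheme) : 'M[R]_dimC :=
  (Qmx s + (Qmx s)^T - (Mmx s)^T *m Qmx s)%R.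

Definition metrics_ok (s : scheme) : Prop :=
  [/\ symm M, symm Om, symm Th & symm Ga] /\
  [/\ Th \in unitmx, Ga \in unitmx
    & match s with
      | MIX_IV => [/\ pd M, pd Th, pd Ga, psd Om
                    & pd (M - (A^T *m Th *m A + B^T *m Ga *m B))%R]
      | _ => pd (Smx s) /\ pd (Gmx s)
      end].

Definition proximal_step (s : scheme) (c ct : 'cV[R]_dimC) : Prop :=
  exists2 v, opA ct v & (v + Qmx s *m (ct - c) = 0)%R.

Definition explicit_step (s : scheme) (c c' : 'cV[R]_dimC) : Prop :=
  let x := cx c in let a := ca c in let b := cb c in let p := cp c in
  let x' := cx c' in let a' := ca c' in let b' := cb c' in let p' := cp c' in
  let hs := conjugate h in
  match s with
  | MIX_I =>
    [/\ Pmin f M (M *m x - A^T *m p - B^T *m b)%R x',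
        Pmin g Om (Om *m a + p)%R a',
        prox hs (invmx Ga) (b + Ga *m B *m (2 *: x' - x))%R b'
      & p' = (p + Th *m (A *m (2 *: x' - x) - (2 *: a' - a)))%R]
  | MIX_II =>
    [/\ Pmin f M (M *m x - B^T *m b - A^T *m p)%R x',
        p' = (p + Th *m (A *m (2 *: x' - x) - a))%R,
        Pmin g Om (Om *m a + 2 *: p' - p)%R a'
      & prox hs (invmx Ga) (b + Ga *m B *m (2 *: x' - x))%R b']
  | MIX_III =>
    [/\ Pmin f (M + A^T *m Th *m A)%R
          (M *m x + A^T *m Th *m a - B^T *m b - A^T *m p)%R x',
        p' = (p + Th *m (A *m x' - a))%R,
        Pmin g Om (Om *m a + 2 *: p' - p)%R a'
      & prox hs (invmx Ga) (b + Ga *m B *m (2 *: x' - x))%R b']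
  | MIX_IV =>
    [/\ Pmin f M (M *m x - A^T *m p - B^T *m b)%R x',
        Pmin g (Om + Th)%R (Om *m a + p + Th *m A *m x')%R a',
        (exists2 bt, prox hs (invmx Ga) (b + Ga *m B *m x')%R bt
                   & b' = (bt + Ga *m B *m (x' - x))%R)
      & p' = (p + Th *m (2 *: (A *m x') - A *m x - a'))%R]
  | MIX_V =>
    [/\ Pmin f M (M *m x - A^T *m p - B^T *m b)%R x',
        Pmin g Om (Om *m a + p)%R a',
        (exists2 bt, prox hs (invmx Ga) (b + Ga *m B *m x')%R bt
                   & b' = (bt + Ga *m B *m (x' - x))%R)
      & p' = (p + Th *m (A *m (2 *: x' - x) - (2 *: a' - a)))%R]
  | MIX_VI =>
    [/\ Pmin f (M + A^T *m Th *m A)%R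
          (M *m x + A^T *m Th *m a - B^T *m b - A^T *m p)%R x',
        Pmin g Om (Om *m a + Th *m A *m x' - Th *m a + p)%R a',
        prox hs (invmx Ga) (b + Ga *m B *m (2 *: x' - x))%R b'
      & p' = (p + Th *m (A *m x' - a'))%R]
  end.

(* A scheme may be run in its implicit form (resolvent inclusion for [ct]) or in
   its explicit form (chain of proximal updates for the next iterate).  In the
   explicit form the correction equation determines [ct k], since [Mmx s] is
   invertible. *)
Definition generated (s : scheme) (c ct : nat -> 'cV[R]_dimC) : Prop :=
  forall k,
    (proximal_step s (c k) (ct k) \/ explicit_step s (c k) (c k.+1)) /\
    c k.+1 = (c k + Mmx s *m (ct k - c k))%R.

End Operators.
End Schemes.

Definition ergodic {R : realType} n (ct : nat -> 'cV[R]_n) (k : nat) :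
    'cV[R]_n := (k%:R^-1 *: \sum_(i < k) ct i)%R.

(* Main.v *)
Require Import Defs.
From HB Require Import structures.
From mathcomp Require Import all_boot all_order all_algebra.
From mathcomp Require Import all_classical all_reals all_analysis.
From mathcomp Require Import ring lra.

Import Order.TTheory GRing.Theory Num.Theory.
Import numFieldNormedType.Exports.

Local Open Scope classical_set_scope.
Local Open Scope ring_scope.
Local Open Scope ereal_scope.

(* By Fermat's rule the explicit updates solve the proximal inclusion, so each
   proximal output ct satisfies v in A(ct) with v = - Q (ct - c).  As the linear
   part of A is skew, the subgradient inequalities of f, g and h^* give
   Pi(ct, cs) <= <v, ct - cs>.  Since S M = Q with S symmetric and G positive
   semidefinite, the right-hand side is at most
   (|c - cs|_S^2 - |c' - cs|_S^2) / 2, where c' is the corrected iterate.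
   Summing telescopes, and Jensen's inequality passes to the ergodic point. *)

(** * Inner products, adjoints and definiteness of matrices *)

Section Dot.
Context {R : realType}.
Local Set Implicit Arguments.
Local Unset Strict Implicit.
Local Open Scope ring_scope.

Lemma dotC n (u v : 'cV[R]_n) : dot u v = dot v u.
Proof. by rewrite /dot !mxE; apply: eq_bigr => i _; rewrite !mxE mulrC. Qed.

Lemma dotDr n (u v w : 'cV[R]_n) : dot u (v + w) = dot u v + dot u w.
Proof. by rewrite /dot mulmxDr mxE. Qed.

Lemma dotNr n (u v : 'cV[R]_n) : dot u (- v) = - dot u v.
Proof. by rewrite /dot mulmxN mxE. Qed.

Lemma dotZr n (k : R) (u v : 'cV[R]_n) : dot u (k *: v) = k * dot u v.
Proof. by rewrite /dot -scalemxAr mxE. Qed.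

Lemma dot0r n (u : 'cV[R]_n) : dot u 0 = 0.
Proof. by rewrite /dot mulmx0 mxE. Qed.

Lemma dotDl n (u v w : 'cV[R]_n) : dot (v + w) u = dot v u + dot w u.
Proof. by rewrite dotC dotDr !(dotC u). Qed.

Lemma dotNl n (u v : 'cV[R]_n) : dot (- v) u = - dot v u.
Proof. by rewrite dotC dotNr dotC. Qed.

Lemma dotZl n (k : R) (u v : 'cV[R]_n) : dot (k *: v) u = k * dot v u.
Proof. by rewrite dotC dotZr dotC. Qed.

Definition dot_lin := (dotDr, dotDl, dotNr, dotNl, dotZr, dotZl).

Lemma dot_trmx m n (X : 'M[R]_(m, n)) u v : dot (X^T *m u) v = dot u (X *m v).
Proof. by rewrite /dot trmx_mul trmxK mulmxA. Qed.

Lemma dot_trmxr m n (X : 'M[R]_(m, n)) u v : dot u (X^T *m v) = dot (X *m u) v.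
Proof. by rewrite dotC dot_trmx dotC. Qed.

Lemma dot_col m n (u1 v1 : 'cV[R]_m) (u2 v2 : 'cV[R]_n) :
  dot (col_mx u1 u2) (col_mx v1 v2) = dot u1 v1 + dot u2 v2.
Proof. by rewrite /dot tr_col_mx mul_row_col mxE. Qed.

Lemma dot_symm n (X : 'M[R]_n) u v : symm X -> dot u (X *m v) = dot (X *m u) v.
Proof. by move=> sX; rewrite -dot_trmx sX. Qed.

(** Basis vectors pick out the columns. Block matrix identities can thus be checked on block
    vectors. *)
Lemma mulmx_ext m n (X Y : 'M[R]_(m, n)) :
  (forall v : 'cV_n, X *m v = Y *m v) -> X = Y.
Proof.
move=> XY; apply/matrixP => i j.
by have /colP/(_ i) := XY (delta_mx j 0); rewrite -!colE !mxE.
Qed.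

Lemma symm_dot n (X : 'M[R]_n) :
  (forall u v, dot u (X *m v) = dot (X *m u) v) -> symm X.
Proof.
move=> sX; apply: mulmx_ext => v; apply/colP => i.
have coord (w : 'cV[R]_n) : w i 0 = dot (delta_mx i 0) w.
  by rewrite /dot trmx_delta -rowE mxE.
by rewrite !coord dotC dot_trmx dotC sX.
Qed.

Lemma pd_psd n (X : 'M[R]_n) : pd X -> psd X.
Proof.
move=> [sX X_gt0]; split=> // u.
have [->|u0] := eqVneq u 0; last exact/ltW/X_gt0.
by rewrite /sqnorm mulmx0 dot0r.
Qed.

Lemma symm_inv n (X : 'M[R]_n) : symm X -> symm (invmx X).
Proof. by rewrite /symm trmx_inv => ->. Qed.

End Dot.

(** * Optimality conditions, conjugates and Jensen's inequality *)

Section ConvexFunctions.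
Context {R : realType}.
Local Set Implicit Arguments.
Local Unset Strict Implicit.

(* Along the segment from the minimizer [u] to [w] the quadratic part only
   contributes its first-order term, up to O(t^2). *)
Lemma Pmin_subdiff n (phi : 'cV[R]_n -> \bar R) (B : 'M[R]_n) (w u : 'cV[R]_n) :
  proper_efun phi -> convex_efun phi -> symm B -> Pmin phi B w u ->
  subdiff phi u (w - B *m u)%R.
Proof.
move=> [phiNy [u0 phiu0]] cvx sB umin.
have fin_u : phi u \is a fin_num.
  rewrite fin_numE phiNy /=; apply/negP => /eqP phiu.
  have := umin u0; rewrite /= phiu addye // leye_eq.
  by move: (phiNy u0) phiu0; case: (phi u0).
split=> // v.
have := phiNy v; case phiv: (phi v) => [r| |] // _; last by rewrite leey.
move: fin_u; case phiu: (phi u) => [s| |] // _.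
rewrite -EFinD lee_fin.
set d := (v - u)%R.
set e := (s + dot (w - B *m u) d - r)%R.
suff e_le t : (0 < t <= 1)%R -> (e <= t * (2^-1 * dot d (B *m d)))%R.
  rewrite -subr_le0 -/e.
  set q := (2^-1 * dot d (B *m d))%R in e_le.
  rewrite leNgt; apply/negP => e_gt0.
  (* Taking t = 1 when q <= e/2, and t = e/(2q) < 1 otherwise, forces e <= e/2, which contradicts e
     > 0. *)
  have [q_le|q_gt] := leP q (e / 2)%R; first by have := e_le 1%R; lra.
  have q_gt0 : (0 < q)%R by lra.
  have := e_le (e / 2 / q)%R.
  rewrite divfK ?gt_eqF // divr_gt0 ?divr_gt0 // ler_pdivrMr // mul1r ltW //.
  by move=> /(_ isT); lra.
move=> /andP[t0 t1].
have := cvx v u t; rewrite t1 (ltW t0) phiu phiv => /(_ isT).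
have -> : (t *: v + (1 - t) *: u = u + t *: d)%R.
  by rewrite /d; apply/matrixP => i j; rewrite !mxE; ring.
rewrite {}/e; move: d => d.
rewrite -!EFinM -EFinD => cvx_t.
have := umin (u + t *: d)%R; rewrite /= phiu => /le_trans.
move=> /(_ _ (leeD cvx_t (le_refl _))).
rewrite -!EFinD lee_fin !mulmxDr -!scalemxAr !dot_lin.
rewrite (dot_symm u d sB) (dotC (B *m u)%R) => H; rewrite -(ler_pM2l t0); lra.
Qed.

(** Expanding the square, the prox objective differs from that of [Pmin] with linear term [B *m v]
    only by a constant. *)
Lemma prox_subdiff n (phi : 'cV[R]_n -> \bar R) (B : 'M[R]_n) (v u : 'cV[R]_n) :
  proper_efun phi -> convex_efun phi -> symm B -> prox phi B v u ->
  subdiff phi u (B *m (v - u))%R.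
Proof.
move=> pphi cvx sB umin; rewrite mulmxBr; apply: Pmin_subdiff => // w /=.
have sqE y : (2^-1 * sqnorm B (y - v) =
    2^-1 * dot y (B *m y) - dot (B *m v) y + 2^-1 * dot v (B *m v))%R.
  rewrite /sqnorm mulmxBr !dot_lin (dot_symm v y sB) (dotC y (B *m v)%R).
  by field.
have := umin w.
by rewrite /= !sqE !(EFinD (_ - _)%R) !addeA leeD2rE.
Qed.

(** The conjugate is a supremum of affine functions, one for each y with [phi y] finite; the other y
    contribute only -oo. *)
Lemma convex_conjugate n (phi : 'cV[R]_n -> \bar R) :
  proper_efun phi -> convex_efun (conjugate phi).
Proof.
move=> [phiNy _] u v t /andP[t0 t1].
apply: ge_ereal_sup => _ [y _ <-].
have := phiNy y; case phiy : (phi y) => [r| |] // _; last first.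
  by rewrite addeNy leNye.
have ub z : (dot z y - r)%:E <= conjugate phi z.
  by apply: ereal_sup_ubound; exists y => //; rewrite phiy dotC EFinB.
have t1' : (0 <= 1 - t)%R by rewrite subr_ge0.
apply: le_trans (leeD (lee_wpmul2l _ (ub u)) (lee_wpmul2l _ (ub v)));
  rewrite ?lee_fin //.
rewrite !dot_lin !(dotC y); lra.
Qed.

Lemma conjugate_gtNy n (phi : 'cV[R]_n -> \bar R) (u : 'cV[R]_n) :
  proper_efun phi -> conjugate phi u != -oo.
Proof.
move=> [phiNy [y phiy]].
have : (dot y u)%:E - phi y <= conjugate phi u by apply: ereal_sup_ubound; exists y.
move: (phiNy y) phiy; case: (phi y) => [r| |] // _ _.
by rewrite -EFinB -ltNye; apply: lt_le_trans; rewrite ltNyr.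
Qed.

(** Jensen's inequality, with real upper bounds [r i] so that the averaging takes place in [R]. *)
Lemma convex_mean n (phi : 'cV[R]_n -> \bar R) (u : nat -> 'cV[R]_n)
    (r : nat -> R) k :
  convex_efun phi -> (forall i, phi (u i) <= (r i)%:E) ->
  phi (k.+1%:R^-1 *: \sum_(i < k.+1) u i)%R
    <= (k.+1%:R^-1 * \sum_(i < k.+1) r i)%R%:E.
Proof.
move=> cvx phi_le; elim: k => [|k IHk].
  by rewrite !big_ord_recr !big_ord0 /= invr1 !add0r scale1r mul1r.
have k1 : (k.+1%:R != 0 :> R)%R by rewrite pnatr_eq0.
have k2 : (k.+2%:R != 0 :> R)%R by rewrite pnatr_eq0.
have kE : (k.+2%:R = k.+1%:R + 1 :> R)%R by rewrite -natr1.
(* Weight of the previous mean: both t/(k+1) and 1 - t equal 1/(k+2). *)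
set t : R := (k.+1%:R / k.+2%:R)%R.
have tE : (1 - t = k.+2%:R^-1)%R.
  by rewrite /t -[X in (X - _)%R](divff k2) -mulrBl kE addrAC subrr add0r mul1r.
have t0 : (0 <= t)%R by rewrite /t divr_ge0.
have t1 : (0 <= 1 - t)%R by rewrite tE invr_ge0.
have tk : (t * k.+1%:R^-1 = k.+2%:R^-1)%R by rewrite /t mulrAC divff // mul1r.
rewrite big_ord_recr [in leRHS]big_ord_recr /=.
rewrite scalerDr -{1}tk -{1}tE -scalerA.
have t01 : (0 <= t <= 1)%R by rewrite t0 -subr_ge0.
apply: le_trans (cvx _ _ _ t01) _.
apply: le_trans (leeD (lee_wpmul2l _ IHk) (lee_wpmul2l _ (phi_le _))) _;
  rewrite ?lee_fin //.
by rewrite mulrDr mulrA tk tE.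
Qed.

End ConvexFunctions.

(** * Arithmetic of four-block vectors and matrices *)

Section Blocks.
Context {R : realType} {N M1 M2 : nat}.
Local Set Implicit Arguments.
Local Unset Strict Implicit.
Local Open Scope ring_scope.
Implicit Types (x : 'cV[R]_N) (a p : 'cV[R]_M1) (b : 'cV[R]_M2).

Lemma col4_eta (c : 'cV[R]_(N + (M1 + (M2 + M1)))) :
  c = col4 (cx c) (ca c) (cb c) (cp c).
Proof. by rewrite /col4 !vsubmxK. Qed.

Lemma cx_col4 x a b p : cx (col4 x a b p) = x.
Proof. exact: col_mxKu. Qed.

Lemma ca_col4 x a b p : ca (col4 x a b p) = a.
Proof. by rewrite /ca /col4 col_mxKd col_mxKu. Qed.

Lemma cb_col4 x a b p : cb (col4 x a b p) = b.
Proof. by rewrite /cb /col4 !col_mxKd col_mxKu. Qed.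

Lemma cp_col4 x a b p : cp (col4 x a b p) = p.
Proof. by rewrite /cp /col4 !col_mxKd. Qed.

Definition col4K := (cx_col4, ca_col4, cb_col4, cp_col4).

Lemma add_col4 x a b p x' a' b' p' :
  col4 x a b p + col4 x' a' b' p' = col4 (x + x') (a + a') (b + b') (p + p').
Proof. by rewrite /col4 !add_col_mx. Qed.

Lemma opp_col4 x a b p : - col4 x a b p = col4 (- x) (- a) (- b) (- p).
Proof. by rewrite /col4 !opp_col_mx. Qed.

Lemma dot_col4 x a b p x' a' b' p' :
  dot (col4 x a b p) (col4 x' a' b' p') =
  dot x x' + dot a a' + dot b b' + dot p p'.
Proof. by rewrite /col4 !dot_col !addrA. Qed.

Lemma mul_row4_col4 m (X1 : 'M[R]_(m, N)) (X2 : 'M[R]_(m, M1))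
    (X3 : 'M[R]_(m, M2)) (X4 : 'M[R]_(m, M1)) x a b p :
  row4 X1 X2 X3 X4 *m col4 x a b p = X1 *m x + X2 *m a + X3 *m b + X4 *m p.
Proof. by rewrite /row4 /col4 !mul_row_col !addrA. Qed.

Lemma mul_col4 n (X1 : 'M[R]_(N, n)) (X2 : 'M[R]_(M1, n)) (X3 : 'M[R]_(M2, n))
    (X4 : 'M[R]_(M1, n)) (v : 'cV[R]_n) :
  col4 X1 X2 X3 X4 *m v = col4 (X1 *m v) (X2 *m v) (X3 *m v) (X4 *m v).
Proof. by rewrite /col4 !mul_col_mx. Qed.

End Blocks.

(* Matrix-vector products are generalized so that [mxE] stops at them, which
   leaves an entrywise ring identity. *)
Ltac linear_identity :=
  rewrite ?(mulmxDr, mulmxDl, mulmxBr, mulmxBl, mulmxN, mulNmx, =^~ mulmxA,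
            =^~ scalemxAr);
  rewrite ?mulKmx //;
  repeat match goal with |- context [@mulmx ?T ?m ?n ?q ?X ?y] =>
           move: (@mulmx T m n q X y) => ? end;
  apply/matrixP => ? ?; rewrite !mxE; ring.

Ltac expand_blocks :=
  rewrite ?(add_col4, opp_col4, mul_col4, mul_row4_col4, mul0mx, mul1mx, mulNmx,
            addr0, add0r).

Ltac finish_step stepP pf cf dx pg cg da ph ch db dp zero4 :=
  apply: (stepP _ _ _ (Pmin_subdiff pf cf _ dx) (Pmin_subdiff pg cg _ da)
    (prox_subdiff ph ch _ db)) => //;
  rewrite dp /Qmx; expand_blocks; rewrite zero4; congr col4; linear_identity.

(** * From the explicit updates to the proximal inclusion *)

Section Steps.
Context {R : realType} {N M1 M2 : nat}.
Local Set Implicit Arguments.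
Local Unset Strict Implicit.
Context (f : 'cV[R]_N -> \bar R) (g : 'cV[R]_M1 -> \bar R)
  (h : 'cV[R]_M2 -> \bar R) (A : 'M[R]_(M1, N)) (B : 'M[R]_(M2, N)).
Context (M : 'M[R]_N) (Om Th : 'M[R]_M1) (Ga : 'M[R]_M2).

Let dim := (N + (M1 + (M2 + M1)))%N.
Implicit Types (c ct : 'cV[R]_dim) (s : scheme).

(** The three minimizations supply the subgradients of f, g and h^*. Once the update of p is
    substituted, the inclusion is a linear identity in each block. *)
Lemma explicit_proximal s c ct :
  proper_efun f -> convex_efun f -> proper_efun g -> convex_efun g ->
  proper_efun (conjugate h) -> convex_efun (conjugate h) ->
  symm M -> symm Om -> symm Th -> symm Ga -> Th \in unitmx -> Ga \in unitmx ->
  explicit_step f g h A B M Om Th Ga s c (c + Mmx A B Th Ga s *m (ct - c))%R ->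
  proximal_step f g h A B M Om Th Ga s c ct.
Proof.
move=> pf cf pg cg ph ch sM sOm sTh sGa uTh uGa.
have sOmTh : symm (Om + Th)%R by rewrite /symm linearD /= sOm sTh.
have sMA : symm (M + A^T *m Th *m A)%R.
  by rewrite /symm linearD /= sM !trmx_mul trmxK sTh mulmxA.
have sGa' := symm_inv sGa.
rewrite (col4_eta c) (col4_eta ct).
move: (cx c) (ca c) (cb c) (cp c) => x a b p.
move: (cx ct) (ca ct) (cb ct) (cp ct) => x' a' b' p'.
have stepP vf vg vh :
    subdiff f x' vf -> subdiff g a' vg -> subdiff (conjugate h) b' vh ->
    (col4 (vf + B^T *m b' + A^T *m p') (vg - p') (vh - B *m x') (a' - A *m x')
     + Qmx A B M Om Th Ga s *m (col4 x' a' b' p' - col4 x a b p) = 0)%R ->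
    proximal_step f g h A B M Om Th Ga s (col4 x a b p) (col4 x' a' b' p').
  move=> df dg dh e; eexists; last exact: e.
  by exists vf, vg, vh; rewrite !col4K.
have zero4 : 0%R = col4 0 0 0 0 :> 'cV[R]_dim by rewrite /col4 !col_mx0.
have eq_of n (u v z w : 'cV[R]_n) : z = w -> (u - v = z - w)%R -> u = v.
  by move=> -> e; apply/subr0_eq; rewrite e subrr.
case: s stepP => stepP; rewrite /= /Mmx; expand_blocks; rewrite ?col4K;
  rewrite ?(addrC x) ?(addrC a) ?(addrC b) ?(addrC p) ?subrK.
- case=> dx da db dp; finish_step stepP pf cf dx pg cg da ph ch db dp zero4.
- case=> dx dp da db; finish_step stepP pf cf dx pg cg da ph ch db dp zero4.
- case=> dx dp da db; finish_step stepP pf cf dx pg cg da ph ch db dp zero4.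
- case=> dx da [bt db ebt] ep.
  (* The correction and the explicit update add the same multiple of x' - x, so the prox output is
     the b-block of [ct]. *)
  have ? : b' = bt by apply: eq_of ebt _; linear_identity.
  (* Undoing the correction removes the extrapolation from the multiplier update. *)
  have dp : p' = (p + Th *m (A *m x' - a'))%R.
    by apply: eq_of ep _; linear_identity.
  subst bt; finish_step stepP pf cf dx pg cg da ph ch db dp zero4.
- case=> dx da [bt db ebt] ep.
  have ? : b' = bt by apply: eq_of ebt _; linear_identity.
  have dp : p' = (p + Th *m (A *m x' - a'))%R.
    by apply: eq_of ep _; linear_identity.
  subst bt; finish_step stepP pf cf dx pg cg da ph ch db dp zero4.
- case=> dx da db ep.
  (* Undoing the correction by - Theta (a' - a) puts the old a back in place of a'. *)
  have dp : p' = (p + Th *m (A *m x' - a))%R.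
    by apply: eq_of ep _; linear_identity.
  finish_step stepP pf cf dx pg cg da ph ch db dp zero4.
Qed.

End Steps.

(** * Invertibility of the corrections and positivity of the energy forms *)

Section Energy.
Context {R : realType} {N M1 M2 : nat}.
Local Set Implicit Arguments.
Local Unset Strict Implicit.
Context (A : 'M[R]_(M1, N)) (B : 'M[R]_(M2, N)).
Context (M : 'M[R]_N) (Om Th : 'M[R]_M1) (Ga : 'M[R]_M2).
Local Open Scope ring_scope.

Let dim := (N + (M1 + (M2 + M1)))%N.
Implicit Types (d : 'cV[R]_dim) (s : scheme).

(** Each correction is the identity plus a strictly lower block-triangular part of square zero; the
    inverse flips the sign of that part. *)
Lemma Mmx_unit s : Mmx A B Th Ga s \in unitmx.
Proof.
pose inv : 'M[R]_dim :=
  match s with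
  | MIX_I | MIX_II | MIX_III => 1%:M
  | MIX_IV =>
    col4 (row4 1%:M 0 0 0) (row4 0 1%:M 0 0) (row4 (- (Ga *m B)) 0 1%:M 0)
         (row4 (- (Th *m A)) 0 0 1%:M)
  | MIX_V =>
    col4 (row4 1%:M 0 0 0) (row4 0 1%:M 0 0) (row4 (- (Ga *m B)) 0 1%:M 0)
         (row4 (- (Th *m A)) Th 0 1%:M)
  | MIX_VI =>
    col4 (row4 1%:M 0 0 0) (row4 0 1%:M 0 0) (row4 0 0 1%:M 0)
         (row4 0 Th 0 1%:M)
  end.
suff /mulmx1_unit[] : Mmx A B Th Ga s *m inv = 1%:M by [].
apply: mulmx_ext => v; rewrite -mulmxA mul1mx /inv /Mmx.
case: s @inv => _; expand_blocks => //; rewrite (col4_eta v); expand_blocks;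
  congr col4; linear_identity.
Qed.

Lemma Smx_Mmx s : Smx A B M Om Th Ga s *m Mmx A B Th Ga s = Qmx A B M Om Th Ga s.
Proof. by rewrite /Smx mulmxKV // Mmx_unit. Qed.

Lemma sqnorm_Gmx s d :
  sqnorm (Gmx A B M Om Th Ga s) d =
  2 * dot d (Qmx A B M Om Th Ga s *m d)
  - dot (Mmx A B Th Ga s *m d) (Qmx A B M Om Th Ga s *m d).
Proof.
rewrite /sqnorm /Gmx mulmxBl mulmxDl -mulmxA !dot_lin.
set Q := Qmx _ _ _ _ _ _ _; set MM := Mmx _ _ _ _ _.
rewrite (dotC d (Q^T *m d)) (dotC d (MM^T *m _)) !dot_trmx (dotC (Q *m d)).
by ring.
Qed.

Context (metrics : metrics_ok A B M Om Th Ga MIX_IV).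

(* The Schur complement argument: with b = Gamma beta and p = Theta pi, both
   quadratic forms are sums of squares, the cross terms being absorbed by
   |beta - B x|_Gamma^2 + |pi - A x|_Theta^2. *)
Lemma psd_Smx_IV : psd (Smx A B M Om Th Ga MIX_IV).
Proof.
have [[sM sOm sTh sGa] [uTh uGa [pM pTh pGa [_ pOm] pS]]] := metrics.
(* Closed form of Q times the inverse correction, verified by multiplying back by the correction. *)
set S := col4
  (row4 (M + A^T *m Th *m A + B^T *m Ga *m B) 0 (- B^T) (- A^T))
  (row4 0 Om 0 0) (row4 (- B) 0 (invmx Ga) 0) (row4 (- A) 0 0 (invmx Th)).
have -> : Smx A B M Om Th Ga MIX_IV = S.
  rewrite -[RHS](mulmxK (Mmx_unit MIX_IV)); congr (_ *m _).
  apply: mulmx_ext => v; rewrite -mulmxA (col4_eta v) /S /Qmx /Mmx; expand_blocks.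
  congr col4; linear_identity.
have sGa' := symm_inv sGa; have sTh' := symm_inv sTh.
split.
  apply: symm_dot => u v; rewrite (col4_eta u) (col4_eta v) /S; expand_blocks.
  rewrite !dot_col4 !mulmxDl -!mulmxA !dot_lin !dot_trmx !dot_trmxr.
  rewrite (dot_symm _ _ sM) (dot_symm _ _ sTh) (dot_symm _ _ sGa).
  rewrite (dot_symm _ _ sOm) (dot_symm _ _ sTh') (dot_symm _ _ sGa').
  by ring.
move=> u; rewrite (col4_eta u).
rewrite -[cb u](mulKVmx uGa) -[cp u](mulKVmx uTh).
move: (cx u) (ca u) (invmx Ga *m _) (invmx Th *m _) => x a b p.
have [_ /(_ (b - B *m x))] := pd_psd pGa.
have [_ /(_ (p - A *m x))] := pd_psd pTh.
have [_ /(_ x)] := pd_psd pM.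
have := pOm a.
rewrite /sqnorm /S; expand_blocks; rewrite dot_col4 !mulKmx //.
rewrite !mulmxDl !mulmxBr -!mulmxA !dot_lin !dot_trmxr.
rewrite (dot_symm p (A *m x) sTh) (dot_symm b (B *m x) sGa).
rewrite !(dotC (Th *m p)) !(dotC (Ga *m b)).
lra.
Qed.

Lemma sqnorm_Gmx_IV_ge0 d : 0 <= sqnorm (Gmx A B M Om Th Ga MIX_IV) d.
Proof.
have [[sM sOm sTh sGa] [uTh uGa [_ pTh pGa [_ pOm] pS]]] := metrics.
rewrite sqnorm_Gmx (col4_eta d).
rewrite -[cb d](mulKVmx uGa) -[cp d](mulKVmx uTh).
move: (cx d) (ca d) (invmx Ga *m _) (invmx Th *m _) => x a b p.
have [_ /(_ (b - B *m x))] := pd_psd pGa.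
have [_ /(_ (p - A *m x))] := pd_psd pTh.
(* Here the x-block of the form is M alone, so completing the squares leaves M minus the two
   coupling terms, and the domination condition on M enters. *)
have [_ /(_ x)] := pd_psd pS.
have := pOm a.
rewrite /sqnorm /Qmx /Mmx; expand_blocks; rewrite !dot_col4 !mulKmx //.
rewrite !(mulmxDl, mulNmx) !mulmxBr -!mulmxA !dot_lin !dot_trmxr.
rewrite (dot_symm p (A *m x) sTh) (dot_symm b (B *m x) sGa).
rewrite -(dot_symm (A *m x) p sTh) -(dot_symm (B *m x) b sGa).
rewrite !(dotC _ (Th *m p)) !(dotC _ (Ga *m b)).
rewrite !(dotC _ (Th *m (A *m x))) !(dotC _ (Ga *m (B *m x))).
lra.
Qed.

End Energy.

(** * Descent of one iteration *)

Section Descent.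
Context {R : realType} {N M1 M2 : nat}.
Local Set Implicit Arguments.
Local Unset Strict Implicit.
Context (A : 'M[R]_(M1, N)) (B : 'M[R]_(M2, N)).
Context (M : 'M[R]_N) (Om Th : 'M[R]_M1) (Ga : 'M[R]_M2).

Let dim := (N + (M1 + (M2 + M1)))%N.
Implicit Types (c d e ct cs : 'cV[R]_dim) (s : scheme).

Lemma psd_Smx s : metrics_ok A B M Om Th Ga s -> psd (Smx A B M Om Th Ga s).
Proof.
by case: s => ok; [..|exact: psd_Smx_IV| |]; have [_ [_ _ [/pd_psd]]] := ok.
Qed.

Lemma sqnorm_Gmx_ge0 s d :
  metrics_ok A B M Om Th Ga s -> (0 <= sqnorm (Gmx A B M Om Th Ga s) d)%R.
Proof.
by case: s => ok; [..|exact: sqnorm_Gmx_IV_ge0| |];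
  have [_ [_ _ [_ /pd_psd[_]]]] := ok; exact.
Qed.

(* |e|_S^2 - |e + Md|_S^2 = -2 <Q d, d + e> + |d|_G^2, because S M = Q. *)
Lemma correction_descent s e d : metrics_ok A B M Om Th Ga s ->
  (- dot (Qmx A B M Om Th Ga s *m d) (d + e) <=
   2^-1 * (sqnorm (Smx A B M Om Th Ga s) e
           - sqnorm (Smx A B M Om Th Ga s) (e + Mmx A B Th Ga s *m d)))%R.
Proof.
move=> ok; have [sS _] := psd_Smx ok; have := sqnorm_Gmx_ge0 d ok.
rewrite sqnorm_Gmx /sqnorm -(Smx_Mmx A B M Om Th Ga).
move: (Smx _ _ _ _ _ _ _) (Mmx _ _ _ _ _) sS => S MM sS.
rewrite -mulmxA mulmxDr; move: (MM *m d)%R => md.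
rewrite !dot_lin (dot_symm md e sS) (dotC _ d) (dotC _ e); lra.
Qed.

Context (f : 'cV[R]_N -> \bar R) (g : 'cV[R]_M1 -> \bar R)
  (h : 'cV[R]_M2 -> \bar R).

Lemma cu_mean (ct : nat -> 'cV[R]_dim) k :
  cu (ergodic ct k) = (k%:R^-1 *: \sum_(i < k) cu (ct i))%R.
Proof.
have cuD c c' : cu (c + c')%R = (cu c + cu c')%R.
  by rewrite /cu /cx /ca /cb !add_col_mx !linearD.
have cu0 : cu (0 : 'cV[R]_dim)%R = 0%R.
  by rewrite /cu /cx /ca /cb !linear0 !col_mx0.
rewrite -(big_morph _ cuD cu0) /ergodic.
by rewrite /cu /cx /ca /cb !scale_col_mx !linearZ.
Qed.

Lemma convex_qfun : proper_efun f -> proper_efun g -> proper_efun h ->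
  convex_efun f -> convex_efun g -> convex_efun (qfun f g h).
Proof.
move=> pf pg ph cf cg; have ch := convex_conjugate ph.
case: pf pg => [fNy _] [gNy _] u v t t01.
rewrite /qfun !linearD !linearZ /=.
apply: le_trans (leeD (leeD (cf _ _ _ t01) (cg _ _ _ t01)) (ch _ _ _ t01)) _.
(* Distributivity in the extended reals needs sums free of oo - oo; excluding -oo ensures this. *)
have dist (r : R) (x y z : \bar R) : x != -oo -> y != -oo -> z != -oo ->
    (r%:E * (x + y + z) = r%:E * x + r%:E * y + r%:E * z).
  move=> xNy yNy zNy.
  by rewrite !muleDr ?ltninfty_adde_def ?inE ?ltNye ?adde_eq_ninfty ?negb_or ?xNy.
rewrite !dist ?conjugate_gtNy // [leRHS]addeACA.
by rewrite [X in _ <= X + _]addeACA.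
Qed.

(* The linear part of the operator is skew, so the subgradient inequalities of
   f, g and h^* at [ct] combine into a single pairing with v in A(ct). *)
Lemma opA_subgradient ct cs v : opA f g h A B ct v -> zerA f g h A B cs ->
  qfun f g h (cu ct)
    <= qfun f g h (cu cs) + (dot (cv A B cs) (cu ct - cu cs) + dot v (ct - cs))%:E.
Proof.
move=> [vf [vg [vh [[ff fsub] [gf gsub] [hf hsub] ->]]]].
move=> [wf [wg [wh [[ffs _] [gfs _] [hfs _] e0]]]].
(* The last block of the inclusion at [cs] is the primal constraint, which cancels the multiplier
   terms. *)
have {e0} eA : ca cs = (A *m cx cs)%R.
  by move/(congr1 cp): e0; rewrite col4K /cp !linear0 => /esym/subr0_eq.
have -> : (ct - cs = col4 (cx ct - cx cs) (ca ct - ca cs) (cb ct - cb cs)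
    (cp ct - cp cs))%R.
  by rewrite {1}(col4_eta ct) {1}(col4_eta cs); expand_blocks.
have := fsub (cx cs); have := gsub (ca cs); have := hsub (cb cs).
rewrite /qfun /cu !(col_mxKu, col_mxKd) /cv !(opp_col_mx, add_col_mx) !dot_col.
case: (f _) ff => // ? _; case: (g _) gf => // ? _.
case: (conjugate h _) hf => // ? _.
case: (f _) ffs => // ? _; case: (g _) gfs => // ? _.
case: (conjugate h _) hfs => // ? _.
rewrite -!EFinD !lee_fin !dot_lin !dot_trmx eA !(dotC (A *m cx ct)%R).
rewrite !(dotC (ca ct)) !(dotC (B *m cx ct)%R) !(dotC (B *m cx cs)%R); lra.
Qed.

Lemma step_descent s c c' ct cs : metrics_ok A B M Om Th Ga s ->
  proximal_step f g h A B M Om Th Ga s c ct ->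
  c' = (c + Mmx A B Th Ga s *m (ct - c))%R -> zerA f g h A B cs ->
  qfun f g h (cu ct) <= qfun f g h (cu cs) +
    (dot (cv A B cs) (cu ct - cu cs)
     + 2^-1 * (sqnorm (Smx A B M Om Th Ga s) (c - cs)
               - sqnorm (Smx A B M Om Th Ga s) (c' - cs)))%:E.
Proof.
move=> ok [v vA /addr0_eq vE] -> zcs.
apply: le_trans (opA_subgradient vA zcs) _.
rewrite leeD2l // lee_fin lerD2l -[v]opprK vE.
(* With e = c - cs and d = ct - c, the sum d + e is ct - cs and the corrected e is c' - cs. *)
have := correction_descent (c - cs)%R (ct - c)%R ok.
rewrite addrA subrK [(c + _ - cs)%R]addrAC dotNl.
exact.
Qed.

End Descent.

(** * Telescoping and the ergodic rate *)

Theorem theorem5 (R : realType) (N M1 M2 : nat)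
  (f : 'cV[R]_N -> \bar R) (g : 'cV[R]_M1 -> \bar R) (h : 'cV[R]_M2 -> \bar R)
  (A : 'M[R]_(M1, N)) (B : 'M[R]_(M2, N))
  (M : 'M[R]_N) (Om Th : 'M[R]_M1) (Ga : 'M[R]_M2)
  (s : scheme) (c ct : nat -> 'cV[R]_(N + (M1 + (M2 + M1))))
  (cs : 'cV[R]_(N + (M1 + (M2 + M1)))) :
  proper_lsc_convex f -> proper_lsc_convex g -> proper_lsc_convex h ->
  metrics_ok A B M Om Th Ga s ->
  generated f g h A B M Om Th Ga s c ct ->
  zerA f g h A B cs ->
  forall k : nat, (1 <= k)%N ->
    0 <= Pi f g h A B (ergodic ct k) cs /\
    Pi f g h A B (ergodic ct k) cs
      <= ((2 * k%:R)^-1 * sqnorm (Smx A B M Om Th Ga s) (c 0%N - cs)%R)%:E.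
Proof.
move=> [pf _ cf] [pg _ cg] [ph _ _] ok gen zcs [//|k] _.
have ch := @convex_conjugate _ _ h ph.
have pch : proper_efun (conjugate h).
  split; first by move=> u; exact: conjugate_gtNy.
  (* A subgradient of h^* exists at the b-block of the saddle point, so h^* is finite there. *)
  move: zcs => [_ [_ [vh [_ _ [hfin _] _]]]].
  by exists (cb cs); move: hfin; rewrite fin_numE => /andP[].
have prox_step i : proximal_step f g h A B M Om Th Ga s (c i) (ct i).
  have [[//|estep] cE] := gen i; rewrite cE in estep.
  have [[? ? ? ?] [? ? _]] := ok.
  exact: explicit_proximal estep.
have [[qfin qsub] ->] := Pi_bregman (ergodic ct k.+1) pf pg ph zcs.
(* The subgradient inequality of q at the saddle point is the lower bound. *)
move: (qsub (cu (ergodic ct k.+1))).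
have step i := step_descent ok (prox_step i) (gen i).2 zcs.
rewrite /bregman; move: qfin step => /fineK.
move: (fine _) => r <-; set v := cv A B cs; set S := Smx _ _ _ _ _ _ _ => step.
have {}step i : qfun f g h (cu (ct i)) <=
    (r + (dot v (cu (ct i) - cu cs)
          + 2^-1 * (sqnorm S (c i - cs) - sqnorm S (c i.+1 - cs))))%:E := step i.
have := convex_mean k (convex_qfun pf pg ph cf cg) step.
have -> n : (\sum_(i < n) (r + (dot v (cu (ct i) - cu cs)
      + 2^-1 * (sqnorm S (c i - cs) - sqnorm S (c i.+1 - cs)))) =
    n%:R * (r - dot v (cu cs)) + dot v (\sum_(i < n) cu (ct i))
    + 2^-1 * (sqnorm S (c 0%N - cs) - sqnorm S (c n - cs)))%R.
  elim: n => [|n IHn]; first by rewrite !big_ord0 dot0r subrr; ring.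
  by rewrite !big_ord_recr /= IHn -natr1 !dot_lin; ring.
have k0 : (k.+1%:R != 0 :> R)%R by rewrite pnatr_eq0.
rewrite 2!mulrDr mulKf // -(dotZr k.+1%:R^-1) -cu_mean.
have [_ /(_ (c k.+1 - cs)%R)] := psd_Smx ok; rewrite -/S.
move: (sqnorm S (c k.+1 - cs)%R) (sqnorm S (c 0%N - cs)%R) => Dk D0 Dk0.
move: (cu (ergodic ct k.+1)) => u.
(* The upper bound excludes +oo and the lower bound excludes -oo. *)
case: (qfun f g h u) => [q||] //.
rewrite -!(EFinD, EFinN) !lee_fin invfM !dot_lin => up low.
have : (0 <= k.+1%:R^-1 :> R)%R by rewrite invr_ge0.
move: (k.+1%:R^-1)%R up => ki up ki0; have := mulr_ge0 ki0 Dk0.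
split; lra.
Qed.
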